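(* Let $\mathcal{F}$ be a finite nonempty union-closed family of sets, and let $k$ and $n$ be the sizes of a smallest set and of the largest set of $\mathcal{F}$, respectively. Let $f$ be the number of elements $x$ such that $x$ belongs to more than half of the sets of $\mathcal{F}$. Then: \begin{enumerate} \item if $k \geq n-3$, then $f \geq k$; \item if $k = n-4$, then $f \geq k-1$; \item $f \geq \min\{n,\, 2k-n+1\}$. \end{enumerate}
   Context: A family of sets is a collection of pairwise distinct sets. A family $\mathcal{F}$ is union-closed if $A\cup B\in\mathcal{F}$ for all $A,B\in\mathcal{F}$. Since $\mathcal{F}$ is finite and union-closed, it has a unique largest set (the union of all its sets). *)

(* Defs.v *)
From mathcomp Require Import all_boot all_order all_algebra.

Set Implicit Arguments.
Unset Strict Implicit.
Unset Printing Implicit Defensive.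

Definition union_closed (T : finType) (F : {set {set T}}) : Prop :=
  forall A B : {set T}, A \in F -> B \in F -> A :|: B \in F.

Definition smallest_size (T : finType) (F : {set {set T}}) (k : nat) : Prop :=
  exists2 A : {set T}, A \in F &
    #|A| = k /\ forall B : {set T}, B \in F -> #|A| <= #|B|.

Definition largest_size (T : finType) (F : {set {set T}}) (n : nat) : Prop :=
  exists2 A : {set T}, A \in F &
    #|A| = n /\ forall B : {set T}, B \in F -> #|B| <= #|A|.

(* T may be larger than the union of F; since the inequality is strict,
   points outside that union are never counted. *)
Definition majority_elements (T : finType) (F : {set {set T}}) : {set T} :=
  [set x | #|F| < 2 * #|[set A in F | x \in A]|].

(* Main.v *)
(** Pass to the complements of the members in the largest set [U]: they are
    closed under intersection, contain the empty set and have at most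
    [m = n - k] elements, and [n - f] is the number of "light" elements of [U],
    those lying in at least half of the complements.  It has to be shown that
    there are at most [2 m - 1] light elements (if any), at most [m] if
    [m <= 3], and at most 5 if [m = 4].

    The complements have average size below [m], since one of them is empty;
    double counting gives the first bound.  For the others, fix [t] light
    elements and trace the complements on them.  For every set [l] of
    light elements, the average of [|B :&: l|] over the complements [B] is at
    least [|l| / 2].  A trace of size [m] comes from a unique complement, so
    once it is known which of these traces occur, the positive part of the sum
    of the [2 |B :&: l| - |l|] is bounded above, provided that no smaller trace
    meets [l] in more than [|l| / 2] points, while intersections of known traces
    bound the negative part from below.  For [(m, t) = (2, 3), (3, 4), (4, 6)]
    the sets [l] with at most one of the [t] elements missing suffice to reach a
    contradiction, by a computation deciding for the [m]-subsets, one after the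
    other, whether they occur. *)

Require Import Defs.
From mathcomp Require Import all_boot all_order all_algebra.
From mathcomp Require Import zify.

Set Implicit Arguments.
Unset Strict Implicit.
Unset Printing Implicit Defensive.

Import Order.TTheory GRing.Theory Num.Theory.

(** * Traces as bit sequences, and the search for a contradiction *)

Definition meet (u v : bitseq) : bitseq := [seq p.1 && p.2 | p <- zip u v].

Fixpoint bitseqs (t : nat) : seq bitseq :=
  if t is t'.+1 then
    map (cons true) (bitseqs t') ++ map (cons false) (bitseqs t')
  else [:: [::]].

Lemma mem_bitseqs (v : bitseq) : v \in bitseqs (size v).
Proof.
elim: v => [|b v IHv] //=; rewrite mem_cat.
by case: b; rewrite (map_f (cons _) IHv) ?orbT.
Qed.

Definition weight (l v : bitseq) : nat := count id (mask l v).

(* Truncated subtraction: the positive and negative parts of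
   [2 * weight l v - count id l]. *)
Definition gain (l v : bitseq) : nat := 2 * weight l v - count id l.
Definition loss (l v : bitseq) : nat := count id l - 2 * weight l v.

(** A duplicate-free list closed under [meet] stays so; a duplicate would count one loss twice. *)
Definition insert (v : bitseq) (K : seq bitseq) : seq bitseq :=
  foldr (fun w K' => if w \in K' then K' else w :: K') K
    (v :: [seq meet v u | u <- K]).

Definition outweighs (m : nat) (l : bitseq) (K U : seq bitseq) : bool :=
  sumn [seq gain l v | v <- K ++ U & count id v == m]
    < sumn [seq loss l v | v <- K].

Definition risky (t m : nat) (l : bitseq) : seq bitseq :=
  [seq v <- bitseqs t | (count id v < m) && (0 < gain l v)].

(** Index [i = 0] omits no position; [i > 0] omits position [i - 1]. *)
Definition test_sets (t : nat) : seq bitseq :=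
  [seq [seq j.+1 != i | j <- iota 0 t] | i <- iota 0 t.+1].

(* [K] lists traces known to occur, [U] the undecided traces of size [m]; a
   smaller trace that would spoil the estimate for [l] must be refuted by the
   set of all elements.  Conditionals replace [&&] and [||], whose arguments
   call-by-value reduction evaluates eagerly. *)
Definition refuted (t m : nat) (K U : seq bitseq) : bool :=
  has (fun l => if outweighs m l K U then
                  all (fun v => outweighs m (nseq t true) (insert v K) U)
                    (risky t m l)
                else false) (test_sets t).

Fixpoint search (t m : nat) (K U : seq bitseq) : bool :=
  if refuted t m K U then true
  else if U is v :: U' then
    if search t m K U' then search t m (insert v K) U' else false
  else false.

(** The first test makes the full set safe in every branch; the search starts from the empty trace,
    which the largest set provides. *)
Definition excluded (t m : nat) : bool :=
  nilp (risky t m (nseq t true))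
    && search t m [:: nseq t false] [seq v <- bitseqs t | count id v == m].

Lemma mem_insert (v w : bitseq) (K : seq bitseq) :
  w \in insert v K -> (w \in K) || (w \in v :: [seq meet v u | u <- K]).
Proof.
rewrite /insert; elim: (v :: _) => [|u s IHs] /=; first by rewrite orbF.
rewrite (in_cons u s); case: ifP => _.
  by move/IHs/orP => [->|->]; rewrite ?orbT.
by rewrite inE => /orP[-> | /IHs/orP[->|->]]; rewrite ?orbT.
Qed.

Lemma insert_uniq (v : bitseq) (K : seq bitseq) : uniq K -> uniq (insert v K).
Proof.
move=> uK; rewrite /insert; elim: (v :: _) => [|u s IHs] //=.
by case: ifPn => //= ->.
Qed.

Lemma insert_sub (v : bitseq) (K : seq bitseq) :
  {subset v :: K <= insert v K}.
Proof.
have sub (s : seq bitseq) (w : bitseq) : w \in s ++ K ->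
    w \in foldr (fun w K' => if w \in K' then K' else w :: K') K s.
  elim: s => [|u s IHs] //=; rewrite inE => /predU1P[->|/IHs].
    by case: ifP => // _; rewrite mem_head.
  by case: ifP => // _; rewrite inE orbC => ->.
move=> w; rewrite inE => w_vK; apply: sub.
by rewrite /= inE mem_cat; case/orP: w_vK => ->; rewrite ?orbT.
Qed.

(** * Soundness of the search, for an abstract family of traces *)

Section Soundness.

Variables (I : finType) (D : {set I}) (tr : I -> bitseq) (t m : nat).
Hypothesis size_tr : forall i, size (tr i) = t.
Hypothesis tr_meet : forall i j, i \in D -> j \in D ->
  exists2 h, h \in D & tr h = meet (tr i) (tr j).
Hypothesis count_tr : forall i, i \in D -> count id (tr i) <= m.
Hypothesis tr_inj : forall i j, i \in D -> j \in D ->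
  count id (tr i) = m -> tr i = tr j -> i = j.
Hypothesis weight_tr : forall l, size l = t ->
  #|D| * count id l <= 2 * \sum_(i in D) weight l (tr i).

Let occurs (v : bitseq) := exists2 i, i \in D & tr i = v.
Let known (K : seq bitseq) := uniq K /\ forall v, v \in K -> occurs v.
Let covers (V : seq bitseq) :=
  forall v, occurs v -> count id v = m -> v \in V.

Lemma loss_le_gain (l : bitseq) : size l = t ->
  \sum_(i in D) loss l (tr i) <= \sum_(i in D) gain l (tr i).
Proof.
move=> /weight_tr; rewrite -sum_nat_const big_distrr /=.
have : \sum_(i in D) 2 * weight l (tr i) + \sum_(i in D) loss l (tr i) =
       \sum_(i in D) count id l + \sum_(i in D) gain l (tr i).
  rewrite -!big_split; apply: eq_bigr => i _ /=.
  (* Truncation makes both sides the maximum of [2 * weight l (tr i)] and [count id l]. *)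
  by rewrite /loss /gain -!maxnE maxnC.
lia.
Qed.

(** Distinct known traces come from distinct indices, and the remaining losses are nonnegative. *)
Lemma known_loss (l : bitseq) (K : seq bitseq) : known K ->
  sumn [seq loss l v | v <- K] <= \sum_(i in D) loss l (tr i).
Proof.
case=> uK occK; rewrite sumnE big_map.
apply: (@leq_trans (\sum_(v <- K) \sum_(i in D | tr i == v) loss l v)).
  rewrite !big_seq; apply: leq_sum => v /occK[i Di <-].
  by rewrite (bigD1 i) ?Di ?eqxx //= leq_addr.
rewrite (exchange_big_dep (fun i => i \in D)) //=; last by move=> v i _ /andP[].
apply: leq_sum => i Di; rewrite (eq_bigl (pred1 (tr i))) => [|v]; last first.
  by rewrite Di /= eq_sym.
rewrite (eq_bigr (fun=> loss l (tr i))) => [|v /eqP-> //].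
rewrite big_const_seq iter_addn_0 count_uniq_mem //.
by case: (_ \in K); rewrite ?muln1 ?muln0.
Qed.

(** Without risky traces only traces of size [m] gain, and by [tr_inj] each of them arises from at
    most one index. *)
Lemma covers_gain (l : bitseq) (V : seq bitseq) : covers V ->
  (forall v, v \in risky t m l -> ~ occurs v) ->
  \sum_(i in D) gain l (tr i) <= sumn [seq gain l v | v <- V & count id v == m].
Proof.
move=> covV safe; rewrite sumnE big_map big_filter.
rewrite (bigID (fun i => count id (tr i) == m)) /= [X in _ + X]big1 ?addn0; last first.
  move=> i /andP[Di ne_m]; apply/eqP; rewrite -leqn0 leqNgt; apply/negP => gain_gt0.
  apply: (safe (tr i)); last by exists i.
  rewrite mem_filter ltn_neqAle ne_m count_tr //= gain_gt0 /=.
  by rewrite -(size_tr i) mem_bitseqs.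
apply: (@leq_trans (\sum_(i in D | count id (tr i) == m)
                      \sum_(v <- V | (count id v == m) && (tr i == v)) gain l v)).
  apply: leq_sum => i /andP[Di /eqP tr_m].
  have V_i : tr i \in V by apply: covV => //; exists i.
  by rewrite (big_rem _ V_i) /= tr_m !eqxx leq_addr.
rewrite (exchange_big_dep (fun v => count id v == m)) //=; last first.
  by move=> i v _ /andP[].
apply: leq_sum => v v_m.
have [i /andP[Di /eqP tr_i]|no_i] := pickP (fun i => (i \in D) && (tr i == v)); last first.
  by rewrite big1 // => i /andP[/andP[Di _] /andP[_ tr_i]]; move: (no_i i); rewrite Di tr_i.
rewrite (big_pred1 i) // => j; apply/idP/eqP => [|->]; last by rewrite Di tr_i v_m eqxx.
case/andP=> /andP[Dj /eqP tr_m] /andP[_ /eqP tr_j].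
by apply: tr_inj => //; rewrite tr_j.
Qed.

Lemma outweighsP (l : bitseq) (K U : seq bitseq) : size l = t ->
  known K -> covers (K ++ U) -> (forall v, v \in risky t m l -> ~ occurs v) ->
  ~~ outweighs m l K U.
Proof.
move=> size_l knownK covKU safe; rewrite -leqNgt.
apply: leq_trans (known_loss l knownK) _.
exact: leq_trans (loss_le_gain size_l) (covers_gain covKU safe).
Qed.

Lemma known_insert (v : bitseq) (K : seq bitseq) :
  occurs v -> known K -> known (insert v K).
Proof.
move=> [i Di tr_i] [uK occK]; split=> [|w]; first exact: insert_uniq.
case/mem_insert/orP=> [/occK // | /predU1P[->|]]; first by exists i.
case/mapP=> _ /occK[j Dj <-] ->; rewrite -tr_i.
by have [h Dh] := tr_meet Di Dj; exists h.
Qed.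

Hypothesis no_risk : nilp (risky t m (nseq t true)).

Lemma refutedP (K U : seq bitseq) :
  known K -> covers (K ++ U) -> ~~ refuted t m K U.
Proof.
move=> knownK covKU; apply/hasPn => l /mapP[i _ def_l].
have size_l : size l = t by rewrite def_l size_map size_iota.
case: ifP => // out; apply/negP => /allP ref_l.
move: out; apply/negP; apply: outweighsP => // v risky_v occ_v.
(* If the risky [v] occurred, it would be known, and the full set, safe by [no_risk], would refute
   it. *)
have := ref_l v risky_v; apply/negP; apply: outweighsP.
- by rewrite size_nseq.
- exact: known_insert.
- move=> w occ_w w_m; have := covKU w occ_w w_m; rewrite !mem_cat.
  by case/orP=> [Kw|->]; rewrite ?orbT // insert_sub // inE Kw orbT.
- by rewrite (nilP no_risk).
Qed.

Lemma searchP (K U : seq bitseq) :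
  known K -> covers (K ++ U) -> ~~ search t m K U.
Proof.
elim: U K => [|v U IHU] K knownK covKU /=; rewrite (negPf (refutedP _ _)) //.
have [occ_v | abs_v] := boolP (v \in [seq tr i | i in D]).
  case: ifP => // _; apply: IHU => [|w occ_w w_m].
    by apply: known_insert => //; case/imageP: occ_v => i Di ->; exists i.
  have := covKU w occ_w w_m; rewrite !mem_cat inE => /or3P[Kw|/eqP->|->].
  - by rewrite insert_sub // inE Kw orbT.
  - by rewrite insert_sub ?mem_head.
  - by rewrite orbT.
rewrite (negPf (IHU K knownK _)) // => w occ_w w_m.
have := covKU w occ_w w_m; rewrite !mem_cat inE => /or3P[->|/eqP def_w|->] //.
  by case: occ_w => i Di tr_i; case/negP: abs_v; rewrite -def_w -tr_i image_f.
by rewrite orbT.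
Qed.

End Soundness.

(** * Traces of the complements on light elements *)

Section LightElements.

Variables (T : finType) (F : {set {set T}}) (m : nat) (U : {set T}).
Hypothesis F_closed : union_closed F.
Hypothesis FU : U \in F.
Hypothesis sub_U : forall A, A \in F -> A \subset U.
Hypothesis card_U : forall A, A \in F -> #|U :\: A| <= m.

Definition trace (s : seq T) (A : {set T}) : bitseq := [seq x \notin A | x <- s].

Variable s : seq T.
Hypothesis uniq_s : uniq s.
Hypothesis sub_s : {subset s <= U :\: majority_elements F}.

Let sE (A : {set T}) : count id (trace s A) = #|[set x in s | x \notin A]|.
Proof.
rewrite count_map -size_filter -(card_uniqP (filter_uniq _ uniq_s)).
by apply: eq_card => x; rewrite inE mem_filter andbC.
Qed.

Let sub_diff (A : {set T}) : [set x in s | x \notin A] \subset U :\: A.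
Proof.
apply/subsetP => x; rewrite 2!inE => /andP[s_x ->].
by have := sub_s s_x; rewrite inE => /andP[].
Qed.

Lemma trace_setU (A B : {set T}) : trace s (A :|: B) = meet (trace s A) (trace s B).
Proof.
by rewrite /meet zip_map -map_comp; apply: eq_map => x; rewrite /= inE negb_or.
Qed.

Lemma count_trace (A : {set T}) : A \in F -> count id (trace s A) <= m.
Proof. by move=> /card_U; apply: leq_trans; rewrite sE subset_leq_card. Qed.

(** A complement has at most [m] points, so a trace of size [m] is the whole complement. *)
Lemma trace_inj (A B : {set T}) : A \in F -> B \in F ->
  count id (trace s A) = m -> trace s A = trace s B -> A = B.
Proof.
have full C : C \in F -> count id (trace s C) = m ->
    U :\: C = [set x in s | x \notin C].
  move=> FC C_m; apply/esym/eqP; rewrite eqEcard sub_diff -sE C_m.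
  exact: card_U.
move=> FA FB A_m eqAB.
have diff C : C \in F -> C = U :\: (U :\: C).
  by move=> /sub_U/setIidPr; rewrite setDDr setDv set0U.
rewrite (diff A) // (diff B) // (full A) // (full B) -?eqAB //.
congr (_ :\: _); apply/setP => x; rewrite !inE; case: (boolP (x \in s)) => //= sx.
have /eqP := congr1 (nth false ^~ (index x s)) eqAB.
by rewrite !(nth_map x) ?index_mem // nth_index // => /eqP.
Qed.

(** Double counting: each light element is missing from at least half of the members. *)
Lemma weight_trace (l : bitseq) : size l = size s ->
  #|F| * count id l <= 2 * \sum_(A in F) weight l (trace s A).
Proof.
move=> size_l; rewrite -(size_mask size_l).
have -> : \sum_(A in F) weight l (trace s A) =
          \sum_(x <- mask l s) #|[set A in F | x \notin A]|.
  under [RHS]eq_bigr do rewrite -sum1_card.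
  rewrite (exchange_big_dep (fun A => A \in F)) /=; last first.
    by move=> x A _; rewrite inE => /andP[].
  apply: eq_bigr => A FA; rewrite /weight /trace -map_mask count_map -sum1_count.
  by apply: eq_bigl => x /=; rewrite !inE FA.
rewrite mulnC -sum1_size big_distrl big_distrr /= !big_seq.
apply: leq_sum => x /mem_mask/sub_s; rewrite !inE => /andP[+ _].
rewrite -leqNgt mul1n => light.
have := cardsID [set A : {set T} | x \in A] F.
have -> : F :&: [set A : {set T} | x \in A] = [set A in F | x \in A].
  by apply/setP => A; rewrite !inE.
have -> : F :\: [set A : {set T} | x \in A] = [set A in F | x \notin A].
  by apply/setP => A; rewrite !inE andbC.
move: light => /[swap] <-.
by rewrite !mul2n -!addnn leq_add2l leq_add2r.
Qed.

Lemma trace_largest : trace s U = nseq (size s) false.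
Proof.
apply: (@eq_from_nth _ false) => [|i]; rewrite size_map ?size_nseq // => lt_i.
have x0 : T by case: s lt_i.
rewrite (nth_map x0) // nth_nseq lt_i; apply/negPn.
by have := sub_s (mem_nth x0 lt_i); rewrite inE => /andP[].
Qed.

Lemma size_light_lt : 0 < size s -> size s < 2 * m.
Proof.
move=> s_gt0; rewrite ltnNge; apply/negP => le_2m.
have := weight_trace (size_nseq (size s) true).
(* [U] has empty trace, so only [#|F| - 1] members contribute; hence the strict bound. *)
rewrite (bigD1 U) //= {1}/weight trace_largest mask_true ?size_nseq //.
rewrite !count_nseq mul0n mul1n add0n (cardsD1 U F) FU add1n.
have le_m : \sum_(A in F | A != U) weight (nseq (size s) true) (trace s A)
    <= #|F :\ U| * m.
  rewrite -sum_nat_const (eq_bigl (mem (F :\ U))) => [|A]; last first.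
    by rewrite !inE andbC.
  apply: leq_sum => A; rewrite !inE => /andP[_ FA].
  by rewrite /weight mask_true ?size_map // count_trace.
move=> /leq_trans/(_ (leq_mul (leqnn 2) le_m)); rewrite mulnCA.
move=> /leq_trans/(_ (leq_mul (leqnn _) le_2m)).
by rewrite mulSn -[leqRHS]add0n leq_add2r leqNgt s_gt0.
Qed.

Lemma not_excluded : ~~ excluded (size s) m.
Proof.
rewrite /excluded; case: (boolP (nilp _)) => //= no_risk.
apply: (@searchP _ F (trace s)) => //.
- by move=> A; rewrite size_map.
- by move=> A B FA FB; exists (A :|: B); [apply: F_closed | apply: trace_setU].
- exact: count_trace.
- exact: trace_inj.
- by move=> l; apply: weight_trace.
- split=> // v; rewrite inE => /eqP->; exists U => //; exact: trace_largest.
- move=> _ [A FA <-] A_m; rewrite mem_cat mem_filter A_m eqxx /=.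
  by rewrite -[X in bitseqs X](size_map (fun x => x \notin A) s) mem_bitseqs orbT.
Qed.

End LightElements.

(** In each case [t] is one more than the number of light elements allowed for [m]. *)
Lemma excluded_2_3 : excluded 3 2. Proof. by vm_compute. Qed.
Lemma excluded_3_4 : excluded 4 3. Proof. by vm_compute. Qed.
Lemma excluded_4_6 : excluded 6 4. Proof. by vm_compute. Qed.

Local Open Scope ring_scope.

Theorem theorem1 (T : finType) (F : {set {set T}}) (k n f : nat)
    (F_neq0 : F != set0) (F_closed : union_closed F)
    (hk : smallest_size F k) (hn : largest_size F n)
    (hf : f = #|majority_elements F|) :
  [/\ k%:Z >= n%:Z - 3 -> f%:Z >= k%:Z,
      k%:Z = n%:Z - 4 -> f%:Z >= k%:Z - 1
    & f%:Z >= Num.min n%:Z (2 * k%:Z - n%:Z + 1)].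
Proof.
case: hk => A0 FA0 [card_A0 min_k]; case: hn => U FU [card_U max_n].
have sub_U A : A \in F -> A \subset U.
  move=> FA; have : U == A :|: U by rewrite eqEcard subsetUr max_n ?F_closed.
  by move/eqP->; exact: subsetUl.
have le_kn : (k <= n)%N by rewrite -card_A0 -card_U min_k.
have card_diff A : A \in F -> (#|U :\: A| <= n - k)%N.
  by move=> FA; rewrite cardsDS ?sub_U // card_U leq_sub2l // -card_A0 min_k.
have sub_maj : majority_elements F \subset U.
  apply/subsetP => x; rewrite inE => maj_x.
  have /card_gt0P[A] : (0 < #|[set A in F | x \in A]|)%N.
    by rewrite lt0n; apply: contraTneq maj_x => ->; rewrite muln0.
  by rewrite inE => /andP[/sub_U/subsetP]; apply.
have le_fn : (f <= n)%N by rewrite hf -card_U subset_leq_card.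
(* The computations concern one exact [t], so a list of exactly [t] light elements is chosen. *)
have light t : (t <= n - f)%N -> exists s : seq T,
    [/\ uniq s, {subset s <= U :\: majority_elements F} & size s = t].
  move=> le_t; exists (take t (enum (U :\: majority_elements F))); split.
  - by rewrite take_uniq ?enum_uniq.
  - by move=> x /mem_take; rewrite mem_enum.
  - by rewrite size_takel // -cardE cardsDS // card_U -hf.
have light_lt : (0 < n - f -> n - f < 2 * (n - k))%N.
  by case: (light _ (leqnn _)) => s [uniq_s sub_s <-]; apply: size_light_lt sub_s.
have light_excluded t m : excluded t m -> (n - k = m)%N -> (n - f < t)%N.
  move=> exc def_m; rewrite ltnNge; apply/negP => /light[s [uniq_s sub_s size_s]].
  have := not_excluded F_closed FU sub_U card_diff uniq_s sub_s.
  by rewrite size_s def_m exc.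
have e2 := light_excluded _ _ excluded_2_3.
have e3 := light_excluded _ _ excluded_3_4.
have e4 := light_excluded _ _ excluded_4_6.
(* For [n - k <= 1] the first bound follows from [light_lt]; the minimum with [n] covers the case of
   no light elements. *)
clear -le_kn le_fn light_lt e2 e3 e4; split; lia.
Qed.
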